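(* For any integer $k\ge 1$ and any $\mathtt P\in\mathcal A$, the points of $\mathrm{Orbit}^{(k)}(\mathtt P)$ all lie on the line $$\mathfrak L_k:=\Big\{\mathtt A\in\mathcal A\,:\,c_3(\mathtt A)=1-\big(1-c_3(\mathtt P)\big)^k\Big\}.$$
   Context: Boxes are elements of the real vector space $\mathcal B$ of functions $\{0,1\}^4\to\mathbb R$, written $\mathtt P(a,b\,|\,x,y)$. Define $\mathtt{PR}(a,b|x,y)=\frac12\mathbf 1_{a\oplus b=xy}$, $\mathtt{SR}(a,b|x,y)=\frac12\mathbf 1_{a=b}$, $\mathtt I(a,b|x,y)=\frac14$, where $\oplus$ is addition mod 2. These three boxes are affinely independent; let $\mathcal A=\mathrm{Aff}\{\mathtt{PR},\mathtt{SR},\mathtt I\}$ be their affine hull. Every $\mathtt A\in\mathcal A$ is uniquely written $\mathtt A=c_1(\mathtt A)\mathtt{PR}+c_2(\mathtt A)\mathtt{SR}+c_3(\mathtt A)\mathtt I$ with $c_1(\mathtt A)+c_2(\mathtt A)+c_3(\mathtt A)=1$. The product $\boxtimes$ (induced by the wiring $\mathsf W_{\mathrm{BS}}$) is the bilinear operation on $\mathcal B$ $$\mathtt P\boxtimes\mathtt Q(a,b|x,y)=\sum_{a_1,a_2,b_1,b_2\in\{0,1\}}\mathtt P(a_1,b_1|x,y)\,\mathtt Q(a_2,b_2|xa_1,yb_1)\,\mathbf 1_{a=a_1\oplus a_2}\mathbf 1_{b=b_1\oplus b_2}.$$ It is neither commutative nor associative, and $\mathcal A$ is stable under it. $\mathrm{Orbit}^{(k)}(\mathtt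 P)$ is the set of all products of $k$ copies of $\mathtt P$ over all parenthesizations: $\mathrm{Orbit}^{(1)}(\mathtt P)=\{\mathtt P\}$ and, for $k\ge2$, $\mathrm{Orbit}^{(k)}(\mathtt P)=\bigcup_{1\le\ell\le k-1}\{\mathtt Q_1\boxtimes\mathtt Q_2:\mathtt Q_1\in\mathrm{Orbit}^{(\ell)}(\mathtt P),\mathtt Q_2\in\mathrm{Orbit}^{(k-\ell)}(\mathtt P)\}$. *)

(* Defs.v *)
From mathcomp Require Import all_boot all_order all_algebra.
From mathcomp Require Import classical_sets reals.

Set Implicit Arguments.
Unset Strict Implicit.
Unset Printing Implicit Defensive.

Import GRing.Theory Num.Theory.
Local Open Scope classical_set_scope.
Local Open Scope ring_scope.

(* P (a, b, x, y) stands for P(a,b|x,y).  The codomain is R^o, i.e. R seen as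
   a vector space over itself, so that boxes inherit a vectType structure. *)
Definition box (R : realType) : vectType R :=
  {ffun bool * bool * bool * bool -> R^o}.

Definition PR (R : realType) : box R :=
  [ffun t => let: (a, b, x, y) := t in 2^-1 * (a (+) b == (x && y))%:R].

Definition SR (R : realType) : box R :=
  [ffun t => let: (a, b, x, y) := t in 2^-1 * (a == b)%:R].

Definition Ibox (R : realType) : box R := [ffun=> 4^-1].

Definition affine_hull (R : realType) (V : vectType R) (n : nat)
    (X : n.-tuple V) : set V :=
  [set v | exists c : 'I_n -> R,
     \sum_(i < n) c i = 1 /\ v = \sum_(i < n) c i *: X`_i].

Definition boxes3 (R : realType) : 3.-tuple (box R) :=
  [tuple PR R; SR R; Ibox R].

Definition Aff3 (R : realType) : set (box R) := affine_hull (boxes3 R).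

(* The three boxes are even linearly independent (free_boxes3), so the affine
   coordinates of a point of Aff3 are its linear coordinates in <<boxes3>>;
   see Aff3P and c_unique. *)
Definition c1 (R : realType) (A : box R) : R := coord (boxes3 R) 0 A.
Definition c2 (R : realType) (A : box R) : R := coord (boxes3 R) 1 A.
Definition c3 (R : realType) (A : box R) : R := coord (boxes3 R) 2 A.

Definition boxtimes (R : realType) (P Q : box R) : box R :=
  [ffun t => let: (a, b, x, y) := t in
     \sum_(a1 : bool) \sum_(a2 : bool) \sum_(b1 : bool) \sum_(b2 : bool)
       P (a1, b1, x, y) * Q (a2, b2, x && a1, y && b1)
       * (a == a1 (+) a2)%:R * (b == b1 (+) b2)%:R].

Inductive Orbit (R : realType) (P : box R) : nat -> set (box R) :=
| Orbit_one : Orbit P 1 P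
| Orbit_mul (k l : nat) (Q1 Q2 : box R) :
    (2 <= k)%N -> (1 <= l <= k - 1)%N ->
    Orbit P l Q1 -> Orbit P (k - l) Q2 -> Orbit P k (boxtimes Q1 Q2).

Definition Lline (R : realType) (P : box R) (k : nat) : set (box R) :=
  [set A | Aff3 A /\ c3 A = 1 - (1 - c3 P) ^+ k].

Lemma sum_boxes3 (R : realType) (c : 'I_3 -> R) :
  \sum_(i < 3) c i *: (boxes3 R)`_i
  = c 0 *: PR R + c 1 *: SR R + c 2 *: Ibox R.
Proof.
rewrite !big_ord_recr big_ord0 /= add0r.
by congr (c _ *: _ + c _ *: _ + c _ *: _); apply: val_inj.
Qed.

Lemma free_boxes3 (R : realType) : free (boxes3 R).
Proof.
apply/freeP => c; rewrite sum_boxes3 => /ffunP e.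
have := e (false, true, false, false).
have := e (false, false, true, true).
have := e (false, false, false, false).
rewrite !ffunE /= /GRing.scale /= !mulr1 !mulr0 !addr0 !add0r => e1 e2 e3.
have n2 : (2^-1 : R) != 0 by rewrite invr_eq0 pnatr_eq0.
have n4 : (4^-1 : R) != 0 by rewrite invr_eq0 pnatr_eq0.
have z2 : c 2 = 0 by move/eqP: e3; rewrite mulf_eq0 (negPf n4) orbF => /eqP.
move: e2; rewrite z2 mul0r addr0 => /eqP.
rewrite mulf_eq0 (negPf n2) orbF => /eqP z1.
move: e1; rewrite z1 z2 !mul0r !addr0 => /eqP.
rewrite mulf_eq0 (negPf n2) orbF => /eqP z0.
by move=> [[|[|[|//]]] i]; [rewrite -z0|rewrite -z1|rewrite -z2];
  congr c; apply: val_inj.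
Qed.

Lemma c_unique (R : realType) (p q r : R) :
  let A := p *: PR R + q *: SR R + r *: Ibox R in
  [/\ c1 A = p, c2 A = q & c3 A = r].
Proof.
pose c (i : 'I_3) : R := [:: p; q; r]`_i.
have E := sum_boxes3 c; rewrite /c /= in E.
by rewrite /= /c1 /c2 /c3 -E; split; rewrite (coord_sum_free c) ?free_boxes3.
Qed.

Lemma Aff3P (R : realType) (A : box R) :
  Aff3 A <-> c1 A + c2 A + c3 A = 1
             /\ A = c1 A *: PR R + c2 A *: SR R + c3 A *: Ibox R.
Proof.
split=> [[c [s ->]]|[s e]].
  rewrite sum_boxes3; have [-> -> ->] := c_unique (c 0) (c 1) (c 2).
  split=> //; rewrite -s !big_ord_recr big_ord0 /= add0r.
  by congr (c _ + c _ + c _); apply: val_inj.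
exists (fun i => coord (boxes3 R) i A); rewrite sum_boxes3; split=> //.
rewrite -[RHS]s !big_ord_recr big_ord0 /= add0r /c1 /c2 /c3.
by congr (_ + _ + _); congr (coord _ _ _); apply: val_inj.
Qed.

(* Main.v *)
Require Import Defs.
From mathcomp Require Import all_boot all_order all_algebra.
From mathcomp Require Import classical_sets reals.
From mathcomp Require Import ring.
Import GRing.Theory Num.Theory.
Local Open Scope classical_set_scope.
Local Open Scope ring_scope.

(* A box [p PR + q SR + r I] with [p + q + r = 1] has uniform marginals and is
   determined by its correlators [p + q] on inputs with [xy = 0] and [q - p] on
   [xy = 1].  When [xy = 0] the second box is also used on inputs with product
   [0], so the correlators [p + q = 1 - c3] multiply: [1 - c3] is
   multiplicative, hence equal to [(1 - c3 P) ^+ k] on the k-th orbit. *)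

Lemma Aff3_comb (R : realType) (p q : R) :
  Aff3 (p *: PR R + q *: SR R + (1 - (p + q)) *: Ibox R).
Proof.
by apply/Aff3P; case: (c_unique p q (1 - (p + q))) => -> -> ->; split=> //; ring.
Qed.

(** Eliminating the third coefficient leaves two free parameters, so identities between products
    carry no side condition. *)
Lemma Aff3_ex (R : realType) (A : box R) : Aff3 A ->
  exists p q : R, A = p *: PR R + q *: SR R + (1 - (p + q)) *: Ibox R.
Proof.
case/Aff3P=> s e; exists (c1 A), (c2 A).
by rewrite {1}e -s; congr (_ + _ *: _); ring.
Qed.

(* [s] is the coefficient [p''] solving [p'' + q'' = (p + q) (p' + q')] and
   [q'' - p'' = (q - p) (p' + q') - (1 + q - p) p' / 2], the correlators of the
   product on [xy = 0] and [xy = 1]. *)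
Lemma boxtimes_comb (R : realType) (p q p' q' : R) :
  let s := p * (p' + q') + 4^-1 * (1 + q - p) * p' in
  boxtimes (p *: PR R + q *: SR R + (1 - (p + q)) *: Ibox R)
           (p' *: PR R + q' *: SR R + (1 - (p' + q')) *: Ibox R)
  = s *: PR R + ((p + q) * (p' + q') - s) *: SR R
    + (1 - (p + q) * (p' + q')) *: Ibox R.
Proof.
move=> s; rewrite {}/s; apply/ffunP => -[[[a b] x] y].
rewrite !ffunE !big_bool /= !ffunE /GRing.scale /=.
by case: a; case: b; case: x; case: y => /=; field.
Qed.

Lemma boxtimes_Aff3 (R : realType) (A B : box R) : Aff3 A -> Aff3 B ->
  Aff3 (boxtimes A B) /\ 1 - c3 (boxtimes A B) = (1 - c3 A) * (1 - c3 B).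
Proof.
move=> /Aff3_ex[p [q ->]] /Aff3_ex[p' [q' ->]]; rewrite boxtimes_comb.
set s := p * _ + _; have [_ _ ->] := c_unique p q (1 - (p + q)).
have [_ _ ->] := c_unique p' q' (1 - (p' + q')).
have [_ _ ->] := c_unique s ((p + q) * (p' + q') - s)
                          (1 - (p + q) * (p' + q')).
split; last by ring.
(* The first two coefficients add up to [(p + q) * (p' + q')], so the third has the shape that
   [Aff3_comb] asks for. *)
by have := Aff3_comb _ s ((p + q) * (p' + q') - s); rewrite [s + _]addrC subrK.
Qed.

Theorem theorem10 (R : realType) (k : nat) (P : box R)
    (hk : (1 <= k)%N) (hP : Aff3 P) :
  Orbit P k `<=` Lline P k.
Proof.
move=> A; elim=> {k hk A} [|k l A B _ /andP[_ lk] _ [hA eA] _ [hB eB]].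
  by split; rewrite // expr1 subKr.
have [hAB eAB] := boxtimes_Aff3 _ _ _ hA hB; split=> //.
apply: (canRL (subKr 1)); rewrite eAB eA eB !subKr -exprD subnKC //.
(* Subtraction is truncated: the exponents satisfy [l + (k - l) = k] only because [l <= k]. *)
exact: leq_trans lk (leq_subr _ _).
Qed.
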